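(* Let $\tilde c\in\mathbb{R}^{S\times A}$ be a (bounded, time-invariant) falsified cost matrix, i.e. the adversary performs a stealthy attack with bounded $\tilde c(i,a)$ for all $i\in\mathcal S$, $a\in\mathcal A$. Let $(Q_n)_{n\ge 0}$ be the iterates in $\mathbb{R}^{S\times A}$ of the $Q$-learning algorithm with falsified cost, $$Q_{n+1}(i,a)=Q_n(i,a)+a(n)\Big[\beta\min_{b\in\mathcal A}Q_n(\Psi_{n+1}(i,a),b)+\tilde c(i,a)-Q_n(i,a)\Big],\quad i\in\mathcal S,\ a\in\mathcal A,$$ with step sizes satisfying $0<a(n)\le 1$ for $n\ge 0$, $\sum_n a(n)=\infty$, $\sum_n a(n)^2<\infty$. Define $\tilde F:\mathbb{R}^{S\times A}\to\mathbb{R}^{S\times A}$ by $$\tilde F_{ia}(Q)=\beta\sum_{j\in\mathcal S}p(i,j,a)\min_{b\in\mathcal A}Q(j,b)+\tilde c(i,a).$$ Then $\tilde F$ has a unique fixed point $\tilde Q^*$, and $Q_n\to\tilde Q^*$ almost surely as $n\to\infty$.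
   Context: Finite Markov decision process: $\mathcal S=\{1,\dots,S\}$ is a finite state space, $\mathcal A=\{a_1,\dots,a_A\}$ a finite action space, $p(i,j,a)$ is the probability of moving from state $i$ to state $j$ under action $a$ (so $p(i,j,a)\ge 0$ and $\sum_j p(i,j,a)=1$), and $\beta\in(0,1)$ is the discount factor. An attack on cost signals is stealthy if the falsified cost received by the learning agent is the same every time the same state-action pair occurs; thus it is described by a fixed matrix $\tilde c\in\mathbb{R}^{S\times A}$. The random variables $\Psi_{n+1}(i,a)$ ($n\ge0$, $i\in\mathcal S$, $a\in\mathcal A$) are independently simulated $\mathcal S$-valued random variables, $\Psi_{n+1}(i,a)$ having law $p(i,\cdot,a)$. The initial matrix $Q_0\in\mathbb{R}^{S\times A}$ is an arbitrary deterministic matrix. *)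

(* Defs.v *)
From HB Require Import structures.
From mathcomp Require Import all_boot all_order all_algebra finmap.
From mathcomp Require Import all_classical all_reals all_analysis.

Set Implicit Arguments.
Unset Strict Implicit.
Unset Printing Implicit Defensive.

Import Order.TTheory GRing.Theory Num.Theory.
Import numFieldNormedType.Exports.

Local Open Scope classical_set_scope.
Local Open Scope ring_scope.

(* Finite index types carry the discrete sigma-algebra, so that {RV P >-> 'I_n.+1}
   is the type of random variables with values in a finite set. *)
HB.instance Definition _ (n : nat) := isPointed.Build 'I_n.+1 ord0.

HB.instance Definition _ (n : nat) := @isMeasurable.Build default_measure_display
  'I_n.+1 discrete_measurable discrete_measurable0
  discrete_measurableC discrete_measurableU.

(* Mutual independence of a (possibly infinite) family of random variables: the
   product rule for every finite subfamily and all measurable events. *)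
Definition mutually_independent (d d' : measure_display) (Omega : measurableType d)
    (R : realType) (P : probability Omega R) (I : choiceType)
    (T : measurableType d') (X : I -> {RV P >-> T}) : Prop :=
  forall (J : {fset I}) (B : I -> set T), (forall k, k \in J -> measurable (B k)) ->
    P (\bigcap_(k in [set` J]) (X k @^-1` B k)) =
    (\prod_(k <- J) P (X k @^-1` B k))%E.

Section QLearning.
Context (R : realType) (s m : nat).

(* States are 'I_s.+1 and actions 'I_m.+1, so that both sets are nonempty. *)
Local Notation state := 'I_s.+1.
Local Notation action := 'I_m.+1.
Local Notation Qmatrix := 'M[R]_(s.+1, m.+1).

Definition transition_kernel (p : state -> state -> action -> R) : Prop :=
  (forall i j a, 0 <= p i j a) /\ (forall i a, \sum_(j < s.+1) p i j a = 1).

(* The default value of the iterated minimum is itself one of the entries, so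
   this is the minimum over the (nonempty) set of actions. *)
Definition min_action (Q : Qmatrix) (j : state) : R :=
  \big[Order.min/Q j ord0]_(b < m.+1) Q j b.

Definition falsified_bellman (beta : R) (p : state -> state -> action -> R)
    (ct : Qmatrix) (Q : Qmatrix) : Qmatrix :=
  \matrix_(i, a) (beta * (\sum_(j < s.+1) p i j a * min_action Q j) + ct i a).

(* One sample path of the iteration: psi n i a is the state sampled for the pair
   (i, a) in the update from Q_n to Q_(n+1), i.e. the value of Psi_(n+1)(i, a). *)
Fixpoint Qlearning (beta : R) (ct : Qmatrix) (alpha : nat -> R) (Q0 : Qmatrix)
    (psi : nat -> state -> action -> state) (n : nat) : Qmatrix :=
  if n is k.+1 then
    let Q := Qlearning beta ct alpha Q0 psi k in
    \matrix_(i, a) (Q i a +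
      alpha k * (beta * min_action Q (psi k i a) + ct i a - Q i a))
  else Q0.

End QLearning.

(* Main.v *)
(* The Bellman operator F is a beta-contraction for the sup norm, which gives the
   fixed point Q*. Let W be the running average of the sampling noise,
   W_(n+1) = (1 - a(n)) W_n + a(n) M_(n+1); since F is a contraction, the error
   |Q_n - Q* - W_n| contracts up to a multiple of |W_n|, so it suffices that
   W_n -> 0 almost surely. The iterates are bounded, hence
   E[|W_(n+1)|^2 | past] <= (1 - a(n)) |W_n|^2 + c a(n)^2. Thus E|W_n|^2 -> 0 and
   V_n = |W_n|^2 + c sum_(k >= n) a(k)^2 is a nonnegative supermartingale with
   E V_n -> 0, and the maximal inequality P(sup_(k >= n) V_k >= e) <= E V_n / e
   forces V_n -> 0 almost surely. As the samples take finitely many values, every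
   expectation is a finite sum over histories. *)

From HB Require Import structures.
Require Import Defs.
From mathcomp Require Import all_boot all_order all_algebra finmap.
From mathcomp Require Import all_classical all_reals all_analysis.
From mathcomp Require Import ring lra.

Import Order.TTheory GRing.Theory Num.Theory.
Import numFieldNormedType.Exports.

Local Open Scope classical_set_scope.
Local Open Scope ring_scope.

(** * Deterministic averaging recursions *)

(** Once [b n <= e / 2], the excess of [x] over [e / 2] shrinks by the factor [1 - a n]. As (1 -
    a)(1 + t + a) <= 1 + t, a nonnegative excess times one plus the partial sum of [a] does not
    grow, so divergence of the series forces the excess down. *)
Lemma averaging_cvg0 (R : realType) (a b x : R^nat) :
  (forall n, 0 <= a n <= 1) -> series a @ \oo --> +oo -> b @ \oo --> 0 ->
  (forall n, 0 <= x n) ->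
  (forall n, x n.+1 <= (1 - a n) * x n + a n * b n) ->
  x @ \oo --> 0.
Proof.
move=> a01 aoo b0 x0 xS; apply/cvgrPdist_lt => e e0.
have [N _ Nb] : \forall n \near \oo, b n <= e / 2.
  move/cvgrPdist_lt: b0 => /(_ (e / 2)) []; first by lra.
  move=> N _ bN; exists N => // n /bN /=; rewrite sub0r normrN => /ltW.
  exact/le_trans/ler_norm.
(* The positive part lets the bound survive when the excess is negative. *)
pose Z := Num.max (x N - e / 2) 0.
have Z0 : 0 <= Z by rewrite le_max lexx orbT.
have bound k : 0 <= series a (N + k)%N - series a N /\
    (x (N + k)%N - e / 2) * (1 + (series a (N + k)%N - series a N)) <= Z.
  elim: k => [|k [IH1 IH2]]; first by rewrite addn0 subrr addr0 mulr1 le_max lexx.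
  rewrite addnS seriesSr.
  have := xS (N + k)%N; have := Nb _ (leq_addr k N); have /andP[] := a01 (N + k)%N.
  move: (a _) (b _) (x (_ + k)%N) (x _.+1) (series a N) (series a (N + k)) IH1 IH2.
  move=> a' b' y y' s0 s1 IH1 IH2 a'0 a'1 b'e y'le; split; first by lra.
  set t := s1 - s0 in IH1 IH2.
  have -> : s1 + a' - s0 = t + a' by rewrite /t; ring.
  have y'e : y' - e / 2 <= (1 - a') * (y - e / 2) by nra.
  have h1 : (y' - e / 2) * (1 + (t + a')) <=
      (1 - a') * (y - e / 2) * (1 + (t + a')) by apply: ler_wpM2r => //; lra.
  apply: (le_trans h1).
  have [y0|y0] := leP 0 (y - e / 2); last first.
    by apply: le_trans Z0; rewrite mulr_le0_ge0 ?mulr_ge0_le0//; lra.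
  apply: le_trans IH2.
  have -> : (1 - a') * (y - e / 2) * (1 + (t + a')) =
    (y - e / 2) * (1 + t) - (y - e / 2) * (a' * t + a' * a') by ring.
  by rewrite lerBlDr lerDl mulr_ge0// addr_ge0// mulr_ge0.
(* Past this point an excess of [e / 2] would give [e / 2 + Z <= Z]. *)
have [M _ Ma] : \forall n \near \oo, series a N + 2 / e * Z <= series a n.
  by move/cvgryPge: aoo; apply.
exists (N + M)%N => // n /= Nn.
rewrite sub0r normrN ger0_norm//.
have [k nE] : exists k, n = (N + k)%N.
  by exists (n - N)%N; rewrite subnKC// (leq_trans _ Nn)// leq_addr.
have := Ma n (leq_trans (leq_addl _ _) Nn); have [] := bound k; rewrite -nE.
move: (series a n) (series a N) (x n) => s1 s0 y s10 yZ ZM.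
rewrite ltNge; apply/negP => ey.
have e1 : e / 2 * (2 / e * Z) = Z by field; rewrite gt_eqF.
have h1 : (e / 2) * (1 + (s1 - s0)) <= Z.
  by apply: le_trans yZ; apply: ler_wpM2r; lra.
have h2 : (e / 2) * (1 + (2 / e * Z)) <= (e / 2) * (1 + (s1 - s0)).
  by apply: ler_wpM2l; lra.
nra.
Qed.

(** * Sup norm of matrices and the contraction principle *)

Section matrix_norm.
Context (R : realType) (s m : nat).
Implicit Types M : 'M[R]_(s.+1, m.+1).

Lemma mx_entry_le M i j : `|M i j| <= `|M|.
Proof.
rewrite [leRHS]/Num.norm /= mx_normrE.
exact: (le_bigmax _ (fun ij => `|M ij.1 ij.2|) (i, j)).
Qed.

Lemma mx_norm_le M c : (forall i j, `|M i j| <= c) -> `|M| <= c.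
Proof.
move=> Mc; rewrite [leLHS]/Num.norm /= mx_normrE; apply: bigmax_le => [|[i j] _]//.
by rewrite (le_trans _ (Mc ord0 ord0)).
Qed.

(** Presents these matrices as a complete normed space, the setting of Banach's theorem. *)
HB.instance Definition _ :=
  Complete.copy 'M[R]_(s.+1, m.+1) 'M[R]_(s.+1, m.+1).

Lemma contraction_fixed_point (f : 'M[R]_(s.+1, m.+1) -> 'M[R]_(s.+1, m.+1))
    (q : R) : 0 <= q < 1 -> (forall M N, `|f M - f N| <= q * `|M - N|) ->
  exists2 M, f M = M & forall N, f N = N -> N = M.
Proof.
move=> /andP[q0 q1] fq.
have [M _ fM] : exists2 M, setT M & M = f M.
  have fT : set_fun [set: 'M[R]_(s.+1, m.+1)] [set: 'M[R]_(s.+1, m.+1)] f by [].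
  have -> : f = mkfun fT by [].
  apply: banach_fixed_point => //.
  - exists (NngNum q0); split => //= -[M N] _; exact: fq.
  - by exists 0.
exists M => // N fN; apply/eqP; rewrite -subr_eq0 -normr_eq0.
have := fq N M; rewrite fN -fM => h; rewrite eq_le normr_ge0 andbT.
have := normr_ge0 (N - M); nra.
Qed.

End matrix_norm.

(** * Expectations over finite histories and the maximal inequality *)

Section finite_histories.
Context {R : realType} {Y : finType} (rho : Y -> R).
Implicit Types (f g V : seq Y -> R) (h : seq Y).

(* Histories list the most recent sample first. *)
Definition mean n f : R := \sum_(h : n.-tuple Y) (\prod_(y <- h) rho y) * f h.

(* Conditional expectation of f at the next time, given the history h. *)
Definition step f h : R := \sum_y rho y * f (y :: h).

Lemma mean0 f : mean 0 f = f [::].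
Proof.
rewrite /mean (big_pred1 [tuple]) => [|h]; last by rewrite [h]tuple0 [RHS]eqxx.
by rewrite big_nil mul1r.
Qed.

(** Tower property: the head of the tuple is the latest sample, and summing it out first leaves the
    conditional expectation. *)
Lemma meanS n f : mean n.+1 f = mean n (step f).
Proof.
rewrite /mean (reindex (fun z : Y * n.-tuple Y => [tuple of z.1 :: z.2])) /=; last first.
  exists (fun h : n.+1.-tuple Y => (thead h, [tuple of behead h])).
    by move=> [y h] _; rewrite /= theadE; congr pair; apply/val_inj.
  by move=> h _; rewrite [RHS]tuple_eta.
rewrite -(pair_bigA _ (fun y (h : n.-tuple Y) =>
  (\prod_(x <- y :: h) rho x) * f (y :: h))) exchange_big /=.
apply: eq_bigr => h _; rewrite /step mulr_sumr.
by apply: eq_bigr => y _; rewrite big_cons; ring.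
Qed.

Lemma mean_affine n (u v : R) f :
  \sum_y rho y = 1 -> mean n (fun h => u * f h + v) = u * mean n f + v.
Proof.
move=> rho1; elim: n f => [|n IH] f; first by rewrite !mean0.
rewrite !meanS -IH; congr mean; apply/funext => h.
rewrite /step mulr_sumr -[v in RHS]mul1r -rho1 mulr_suml -big_split/=.
by apply: eq_bigr => y _; ring.
Qed.

Hypothesis rho_ge0 : forall y, 0 <= rho y.

Lemma le_step f g h : (forall y, f (y :: h) <= g (y :: h)) -> step f h <= step g h.
Proof. by move=> fg; apply: ler_sum => y _; exact: ler_wpM2l. Qed.

Lemma le_mean n f g : (forall h, size h = n -> f h <= g h) -> mean n f <= mean n g.
Proof.
move=> fg; apply: ler_sum => h _; apply: ler_wpM2l; first exact: prodr_ge0.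
by apply: fg; rewrite size_tuple.
Qed.

(** Suffixes of [h] are the earlier histories, so this records whether [V] reached [e] at some time
    from [n] up to the present. Being Boolean, it can be averaged by [mean]. *)
Fixpoint exceeds V (e : R) (n : nat) h : bool :=
  ((n <= size h)%N && (e <= V h)) || (if h is _ :: h' then exceeds V e n h' else false).

Hypothesis rho_sum1 : \sum_y rho y = 1.

Lemma exceeds_small V e n h : (size h < n)%N -> exceeds V e n h = false.
Proof.
elim: h => [|y h IH] hn /=; first by rewrite orbF leqNgt hn.
by rewrite leqNgt hn /= IH// ltnW.
Qed.

(* The process stopped at level e when V first exceeds it remains a supermartingale. *)
Lemma maximal_inequality V e n k : 0 <= e ->
  (forall h, 0 <= V h) -> (forall h, step V h <= V h) ->
  e * mean (n + k) (fun h => (exceeds V e n h)%:R) <= mean n V.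
Proof.
move=> e0 V0 stepV; pose U h := if exceeds V e n h then e else V h.
have stepU h : (n <= size h)%N -> step U h <= U h.
  move=> nh; rewrite {2}/U; case: ifPn => hh.
    rewrite /step (eq_bigr (fun y => rho y * e)) => [|y _].
      by rewrite -mulr_suml rho_sum1 mul1r.
    by rewrite /U /= hh orbT.
  (* Before any exceedance [U <= V] at the next time: a first exceedance replaces a value at least
     [e] by [e]. *)
  apply: le_trans (stepV h); apply: le_step => y.
  by rewrite /U /= (negbTE hh) orbF; case: ifP => // /andP[].
have UV : mean (n + k) U <= mean n V.
  elim: k => [|k IH].
    (* At time [n] only the current value can trigger the exceedance. *)
    rewrite addn0; apply: le_mean => h hn; rewrite /U; case: ifP => //.
    case: h hn => [|y h] hn /=; first by rewrite orbF => /andP[].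
    by rewrite exceeds_small ?orbF -?hn// => /andP[].
  rewrite addnS meanS; apply: le_trans IH; apply: le_mean => h hn.
  by apply: stepU; rewrite hn leq_addr.
apply: le_trans UV.
(* Markov's inequality: [U] is [e] after an exceedance and nonnegative otherwise. *)
rewrite -[leLHS]addr0 -mean_affine//; apply: le_mean => h _.
by rewrite /U addr0; case: ifP; rewrite ?mulr1 ?mulr0.
Qed.

End finite_histories.

Fixpoint history {Y : Type} (x : nat -> Y) (n : nat) : seq Y :=
  if n is k.+1 then x k :: history x k else [::].

Lemma size_history (Y : Type) (x : nat -> Y) n : size (history x n) = n.
Proof. by elim: n => //= n ->. Qed.

Lemma exceeds_history (R : realType) (Y : finType) (x : nat -> Y) V (e : R) n k :
  exceeds V e n (history x k) <->
  exists2 j, (n <= j <= k)%N & e <= V (history x j).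
Proof.
elim: k => [|k IH] /=.
  rewrite orbF; split => [/andP[n0 eV]|[j]]; first by exists 0; rewrite ?n0.
  by move=> /andP[nj]; rewrite leqn0 => /eqP j0; subst j; rewrite nj => ->.
rewrite size_history; split => [/orP[/andP[nk eV]|/IH[j /andP[nj jk] eV]]|[j]].
- by exists k.+1; rewrite ?nk ?leqnn.
- by exists j; rewrite ?nj ?leqW.
- move=> /andP[nj]; rewrite leq_eqVlt => /orP[/eqP jk|jk] eV.
    by rewrite -jk nj -[x k :: _]/(history x k.+1) -jk eV.
  by apply/orP; right; apply/IH; exists j; rewrite ?nj.
Qed.

(** * Almost sure convergence for processes whose histories have product law *)

Section independent_process.
Context (R : realType) (Y : finType) (rho : Y -> R).
Context (d : measure_display) (Omega : measurableType d) (P : probability Omega R).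
Variable X : nat -> Omega -> Y.
Hypothesis rho_ge0 : forall y, 0 <= rho y.
Hypothesis rho_sum1 : \sum_y rho y = 1.
Let H n w := history (X^~ w) n.
Hypothesis measurable_history : forall h, measurable [set w | H (size h) w = h].
Hypothesis history_law : forall h,
  P [set w | H (size h) w = h] = (\prod_(y <- h) rho y)%:E.

(** Finitely many histories of length [n] exist, so every event about them is a finite union of
    atoms. *)
Let history_split n (B : pred (seq Y)) : [set w | B (H n w)] =
  \big[setU/set0]_(h : n.-tuple Y | B h) [set w | H (size h) w = h].
Proof.
rewrite -bigcup_seq_cond; apply/seteqP; split => w /=.
  move=> BH; have sz : size (H n w) == n by rewrite size_history.
  by exists (Tuple sz) => /=; rewrite ?mem_index_enum// size_history.
by move=> -[h /= /andP[_ Bh]]; rewrite size_tuple => ->.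
Qed.

Lemma measurable_history_event n (B : pred (seq Y)) : measurable [set w | B (H n w)].
Proof. by rewrite history_split; apply: bigsetU_measurable => h _. Qed.

(** A path has one history of each length, so the atoms are disjoint and their probabilities add up
    to a finite mean. *)
Lemma history_probability n (B : pred (seq Y)) :
  P [set w | B (H n w)] = (mean rho n (fun h => (B h)%:R))%:E.
Proof.
rewrite history_split -big_filter -bigcup_seq measure_fin_bigcup//.
- rewrite -fsbig_seq; last by rewrite filter_uniq// index_enum_uniq.
  rewrite big_filter big_mkcond /mean -sumEFin; apply: eq_bigr => h _.
  by case: ifP; rewrite ?mulr1 ?mulr0// => _; exact: history_law.
- move=> h1 h2 _ _ [w /= []]; rewrite !size_tuple => h1w h2w.
  by apply/val_inj; rewrite /= -h1w -h2w.
Qed.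

Lemma supermartingale_cvg0 V :
  (forall h, 0 <= V h) -> (forall h, step rho V h <= V h) ->
  mean rho n V @[n --> \oo] --> 0 ->
  {ae P, forall w, V (H n w) @[n --> \oo] --> 0}.
Proof.
move=> V0 stepV EV0.
(* The countably many levels [k.+1%:R^-1] suffice, so the exceptional null sets can be merged. *)
suff Ve e : 0 < e -> {ae P, forall w, exists n, forall j, (n <= j)%N -> V (H j w) < e}.
  have : {ae P, forall w, forall k, exists n,
      forall j, (n <= j)%N -> V (H j w) < k.+1%:R^-1}.
    by apply: ae_foralln => k; apply: Ve; rewrite invr_gt0.
  apply: filterS => w Vw; apply/cvgrPdist_lt => e e0.
  have [k ke] : exists k, k.+1%:R^-1 < e.
    have [k _ ke] := near_infty_natSinv_lt (PosNum e0).
    by exists k; apply: (ke k) => /=.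
  have [n nV] := Vw k; exists n => // j /= /nV Vk.
  by rewrite sub0r normrN ger0_norm// (lt_trans Vk).
move=> e0.
pose A n k := [set w | exceeds V e n (H (n + k) w)].
pose Bad n := \bigcup_k A n k.
have mA n k : measurable (A n k) by exact: (measurable_history_event _ (exceeds V e n)).
have mBad n : measurable (Bad n) by exact: bigcup_measurable.
have PBad n : (P (Bad n) <= (mean rho n V / e)%:E)%E.
  (* The maximal inequality covers finite windows; continuity from below extends it to all times
     after [n]. *)
  have Acvg : P (A n k) @[k --> \oo] --> P (Bad n).
    apply: nondecreasing_cvg_mu; [exact: mA|exact: mBad|move=> k l kl].
    apply/subsetPset => w /=.
    move=> /exceeds_history[j /andP[nj jk] eV]; apply/exceeds_history.
    by exists j; rewrite // nj (leq_trans jk)// leq_add2l.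
  rewrite -(cvg_lim _ Acvg)//; apply: lime_le.
    by apply/cvg_ex; exists (P (Bad n)).
  apply: nearW => k; rewrite [P _]history_probability lee_fin ler_pdivlMr// mulrC.
  by apply: maximal_inequality => //; exact: ltW.
(* The null set consists of the paths that reach [e] at arbitrarily late times. *)
exists (\bigcap_n Bad n); split.
- exact: bigcap_measurableType.
- have PN n : (P (\bigcap_n Bad n) <= (mean rho n V / e)%:E)%E.
    apply: le_trans (PBad n); apply: le_measure; rewrite ?inE//.
      exact: bigcap_measurableType.
    exact: bigcap_inf.
  apply/eqP; rewrite eq_le measure_ge0 andbT; apply/lee_addgt0Pr => r r0.
  rewrite add0e.
  have [n _ nV] : \forall n \near \oo, mean rho n V < r * e.
    have re : 0 < r * e by rewrite mulr_gt0.
    move/cvgrPdist_lt: EV0 => /(_ _ re); apply: filterS => n.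
    by rewrite sub0r normrN; exact/le_lt_trans/ler_norm.
  by apply: le_trans (PN n) _; rewrite lee_fin ler_pdivrMr// ltW// nV/=.
- move=> w /= wN n _; apply: contrapT => wBad; apply: wN; exists n => j nj.
  rewrite ltNge; apply/negP => eV; apply: wBad; exists j => //=.
  by apply/exceeds_history; exists j; rewrite // nj leq_addl.
Qed.

Lemma robbins_monro_cvg0 (a : R^nat) (c : R) (f : seq Y -> R) :
  (forall n, 0 < a n) -> (forall n, a n <= 1) -> series a @ \oo --> +oo ->
  cvgn (series (fun n => a n ^+ 2)) -> 0 <= c -> (forall h, 0 <= f h) ->
  (forall h, step rho f h <= (1 - a (size h)) * f h + c * a (size h) ^+ 2) ->
  {ae P, forall w, f (H n w) @[n --> \oo] --> 0}.
Proof.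
move=> a0 a1 aoo a2 c0 f0 stepf.
pose q := series (fun n => a n ^+ 2).
have tail0 : (c * (limn q - q n)) @[n --> \oo] --> 0.
  rewrite -[X in _ --> X](mulr0 c); apply: cvgMr.
  by rewrite -(subrr (limn q)); apply: cvgB => //; exact: cvg_cst.
have tail_ge0 n : 0 <= c * (limn q - q n).
  rewrite mulr_ge0// subr_ge0; apply: nondecreasing_cvgn_le => //.
  by apply/nondecreasing_seqP => k; rewrite /q seriesSr lerDl sqr_ge0.
have Ef0 : mean rho n f @[n --> \oo] --> 0.
  (* The term [c * a n ^+ 2] is read as the weight [a n] times [c * a n], which tends to 0 by square
     summability. *)
  apply: (averaging_cvg0 R a (fun n => c * a n)) => //.
  - by move=> n; rewrite ltW//= a1.
  - rewrite -[X in _ --> X](mulr0 c); apply: cvgMr.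
    have /cvgrPdist_lt a20 := cvg_series_cvg_0 a2.
    apply/cvgrPdist_lt => e e0; have := a20 (e ^+ 2); rewrite exprn_gt0// => /(_ isT).
    apply: filterS => n; rewrite !sub0r !normrN normrX ltr_pXn2r// ?nnegrE ltW//.
  - move=> n; have <- : mean rho n (fun=> 0) = 0.
      by rewrite /mean big1// => h _; rewrite mulr0.
    by apply: le_mean.
  - move=> n; rewrite meanS mulrCA -expr2 -mean_affine//.
    by apply: le_mean => // h hn; rewrite -hn.
(* Each step lowers the tail of the series of squares by exactly the amount that pays for the noise
   term. *)
pose V h := f h + c * (limn q - q (size h)).
have V0 h : 0 <= V h by rewrite addr_ge0.
have stepV h : step rho V h <= V h.
  have -> : step rho V h = step rho f h + c * (limn q - q (size h).+1).
    rewrite /step -[X in _ + X]mul1r -rho_sum1 mulr_suml -big_split /=.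
    by apply: eq_bigr => y _; rewrite /V mulrDr.
  rewrite /V /q seriesSr; have := stepf h; have := f0 h.
  by have := a0 (size h); nra.
have EV0 : mean rho n V @[n --> \oo] --> 0.
  rewrite (_ : (fun n => mean rho n V) = fun n => mean rho n f + c * (limn q - q n)).
    by rewrite -[X in _ --> X]addr0; exact: cvgD.
  apply/funext => n; rewrite -[mean rho n f]mul1r -mean_affine//.
  apply: eq_bigr => h _; by rewrite /V mul1r size_tuple.
have := supermartingale_cvg0 _ V0 stepV EV0; apply: filterS => w.
apply: squeeze_cvgr; last exact: cvg_cst.
by apply: nearW => n; rewrite f0/= lerDl.
Qed.

End independent_process.

(** * Regularity of the minimum over actions *)

Section min_action.
Context {R : realType} {s m : nat}.
Implicit Types Q : 'M[R]_(s.+1, m.+1).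

Lemma min_action_le Q Q' j : min_action Q j <= min_action Q' j + `|Q - Q'|.
Proof.
have le_entry b : min_action Q j - `|Q - Q'| <= Q' j b.
  rewrite lerBlDr; apply: (le_trans (bigmin_le _ b _)).
  rewrite -lerBlDl (le_trans (ler_norm _))//.
  by have := mx_entry_le _ _ _ (Q - Q') j b; rewrite !mxE.
(* The default value of the minimum is an entry too, so [le_entry] also covers it. *)
by rewrite -lerBlDr; apply: le_bigmin.
Qed.

Lemma min_action_lipschitz Q Q' j : `|min_action Q j - min_action Q' j| <= `|Q - Q'|.
Proof.
rewrite ler_norml lerBlDl min_action_le andbT lerNl opprB lerBlDl.
by rewrite -normrN opprB min_action_le.
Qed.

Lemma min_action_norm Q j : `|min_action Q j| <= `|Q|.
Proof.
have -> : min_action Q j = min_action Q j - min_action (0 : 'M[R]_(s.+1, m.+1)) j.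
  rewrite [X in _ - X](_ : _ = 0) ?subr0// /min_action !mxE.
  by elim/big_ind: _ => [//|x y -> ->|b _]; rewrite ?minxx// mxE.
by rewrite (le_trans (min_action_lipschitz _ _ _))// subr0.
Qed.

End min_action.

(** * Iterates, noise and error as functions of the history *)

Section Qlearning_histories.
Context {R : realType} {s m : nat}.
Variables (p : 'I_s.+1 -> 'I_s.+1 -> 'I_m.+1 -> R) (beta : R) (ct : 'M[R]_(s.+1, m.+1)).
Variables (alpha : nat -> R) (Q0 : 'M[R]_(s.+1, m.+1)).
Hypothesis p_kernel : transition_kernel p.
Hypotheses (beta_gt0 : 0 < beta) (beta_lt1 : beta < 1).
Hypotheses (alpha_gt0 : forall n, 0 < alpha n) (alpha_le1 : forall n, alpha n <= 1).

Lemma kernel_mean_norm i a (g : 'I_s.+1 -> R) c : (forall j, `|g j| <= c) ->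
  `|\sum_j p i j a * g j| <= c.
Proof.
case: p_kernel => p0 p1 gc; apply: (le_trans (ler_norm_sum _ _ _)).
rewrite -[c]mul1r -(p1 i a) mulr_suml; apply: ler_sum => j _.
by rewrite normrM ger0_norm// ler_wpM2l.
Qed.

(** Minimising over actions and averaging over successors are both nonexpansive, and the cost
    cancels; only the factor [beta] remains. *)
Lemma falsified_bellman_contraction Q Q' :
  `|falsified_bellman beta p ct Q - falsified_bellman beta p ct Q'| <= beta * `|Q - Q'|.
Proof.
apply: mx_norm_le => i a; rewrite !mxE.
rewrite [X in `|X|](_ : _ = beta * \sum_j p i j a * (min_action Q j - min_action Q' j)).
  rewrite normrM (gtr0_norm beta_gt0) ler_pM2l//; apply: kernel_mean_norm => j.
  exact: min_action_lipschitz.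
under [in RHS]eq_bigr do rewrite mulrBr.
by rewrite sumrB; ring.
Qed.

(* One joint sample: the successor state drawn for every state-action pair. *)
Definition sample : finType := {ffun 'I_s.+1 * 'I_m.+1 -> 'I_s.+1}.

(** A product measure, since the draws for different pairs are independent. *)
Definition sample_law (y : sample) : R := \prod_ia p ia.1 (y ia) ia.2.

Lemma sample_law_ge0 y : 0 <= sample_law y.
Proof. by case: p_kernel => p0 _; exact: prodr_ge0. Qed.

(** Insert [g] into the factor at [(i, a)] and exchange product and sum: every other factor sums to
    1. *)
Lemma sample_law_marginal i a (g : 'I_s.+1 -> R) :
  \sum_y sample_law y * g (y (i, a)) = \sum_j p i j a * g j.
Proof.
case: p_kernel => p0 p1.
pose F ia j := p ia.1 j ia.2 * (if ia == (i, a) then g j else 1).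
transitivity (\prod_ia \sum_j F ia j).
  rewrite bigA_distr_bigA; apply: eq_bigr => y _.
  by rewrite /F big_split /= -big_mkcond big_pred1_eq.
rewrite (bigD1 (i, a))//= [X in _ * X]big1 ?mulr1.
  by apply: eq_bigr => j _; rewrite /F eqxx.
move=> ia /negbTE ne; rewrite -[RHS](p1 ia.1 ia.2).
by apply: eq_bigr => j _; rewrite /F ne mulr1.
Qed.

Lemma sample_law_sum1 : \sum_y sample_law y = 1.
Proof.
case: p_kernel => p0 p1; rewrite -(p1 ord0 ord0).
have := sample_law_marginal ord0 ord0 (fun=> 1).
by under eq_bigr do rewrite mulr1; under [in RHS]eq_bigr do rewrite mulr1.
Qed.

(** [size h'] counts the earlier updates, hence indexes the step size of the latest one. *)
Fixpoint Qhist (h : seq sample) : 'M[R]_(s.+1, m.+1) :=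
  if h is y :: h' then
    \matrix_(i, a) (Qhist h' i a + alpha (size h') *
      (beta * min_action (Qhist h') (y (i, a)) + ct i a - Qhist h' i a))
  else Q0.

Lemma Qlearning_history (x : nat -> sample) n :
  Qlearning beta ct alpha Q0 (fun k i a => x k (i, a)) n = Qhist (history x n).
Proof.
by elim: n => //= n ->; rewrite size_history; apply/matrixP => i a; rewrite !mxE.
Qed.

(** The second term makes [beta * Qbound + |ct| <= Qbound], so the ball of this radius is invariant
    under the updates. *)
Definition Qbound : R := Num.max `|Q0| (`|ct| / (1 - beta)).

Lemma Qhist_bounded h : `|Qhist h| <= Qbound.
Proof.
elim: h => [|y h IH] /=; first by rewrite le_max lexx.
apply: mx_norm_le => i a; rewrite mxE.
have ctB : `|ct| <= (1 - beta) * Qbound.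
  by rewrite mulrC -ler_pdivrMr ?subr_gt0// le_max lexx orbT.
have := alpha_gt0 (size h); have := alpha_le1 (size h); move: (alpha _) => t t1 t0.
have := le_trans (mx_entry_le _ _ _ (Qhist h) i a) IH.
have := le_trans (mx_entry_le _ _ _ ct i a) ctB.
have := le_trans (min_action_norm (Qhist h) (y (i, a))) IH.
move: (min_action _ _) (Qhist h i a) (ct i a) Qbound => u v c M.
rewrite !ler_norml => /andP[u1 u2] /andP[c1 c2] /andP[v1 v2].
have bu1 : - (beta * M) <= beta * u by rewrite -mulrN ler_pM2l.
have bu2 : beta * u <= beta * M by rewrite ler_pM2l.
(* The update is a convex combination of the old entry and a target, both bounded by [M]. *)
have -> : v + t * (beta * u + c - v) = (1 - t) * v + t * (beta * u + c) by ring.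
have l1 : (1 - t) * v <= (1 - t) * M by apply: ler_wpM2l => //; lra.
have l2 : (1 - t) * (- M) <= (1 - t) * v by apply: ler_wpM2l => //; lra.
have l3 : t * (beta * u + c) <= t * M by apply: ler_wpM2l; lra.
have l4 : t * (- M) <= t * (beta * u + c) by apply: ler_wpM2l; lra.
apply/andP; split; lra.
Qed.

(** The martingale difference: the sampled target minus its conditional expectation. *)
Definition noise h (y : sample) i a : R :=
  beta * (min_action (Qhist h) (y (i, a)) - \sum_j p i j a * min_action (Qhist h) j).

Fixpoint noise_avg (h : seq sample) : 'M[R]_(s.+1, m.+1) :=
  if h is y :: h' then
    \matrix_(i, a) ((1 - alpha (size h')) * noise_avg h' i a +
      alpha (size h') * noise h' y i a)
  else 0.

Lemma noise_mean0 h i a : \sum_y sample_law y * noise h y i a = 0.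
Proof.
rewrite (sample_law_marginal i a (fun k => beta * (min_action (Qhist h) k -
  \sum_j p i j a * min_action (Qhist h) j))).
case: p_kernel => p0 p1.
under eq_bigr do rewrite mulrCA mulrBr.
by rewrite -mulr_sumr sumrB -mulr_suml p1 mul1r subrr mulr0.
Qed.

Lemma noise_bounded h y i a : `|noise h y i a| <= 2 * Qbound.
Proof.
have B k : `|min_action (Qhist h) k| <= Qbound.
  exact: le_trans (min_action_norm _ _) (Qhist_bounded h).
have B0 : 0 <= Qbound by apply: le_trans (B ord0).
rewrite /noise normrM (gtr0_norm beta_gt0) -[leRHS]mul1r.
apply: ler_pM => //; [exact: ltW|exact: ltW|].
apply: (le_trans (ler_normB _ _)); have := kernel_mean_norm i a _ _ B.
by have := B (y (i, a)); lra.
Qed.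

(** The squared Euclidean norm replaces the sup norm because its conditional expectation can be
    computed entry by entry. *)
Definition energy h : R := \sum_ia noise_avg h ia.1 ia.2 ^+ 2.

Definition noise_var : R := \sum_(ia : 'I_s.+1 * 'I_m.+1) (2 * Qbound) ^+ 2.

(** On expanding the square, the cross term vanishes by [noise_mean0], [(1 - t) ^+ 2 <= 1 - t] for
    steps in (0, 1], and the squared noise is bounded. *)
Lemma step_energy h : step sample_law energy h <=
  (1 - alpha (size h)) * energy h + noise_var * alpha (size h) ^+ 2.
Proof.
rewrite /step /energy; under eq_bigr do rewrite mulr_sumr.
rewrite exchange_big mulr_sumr mulr_suml -big_split; apply: ler_sum => -[i a] _ /=.
set t := alpha _; set u := noise_avg h i a.
under eq_bigr => y _.
  rewrite mxE -/t -/u (_ : sample_law y * _ = (1 - t) ^+ 2 * u ^+ 2 * sample_law y +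
    2 * (1 - t) * u * t * (sample_law y * noise h y i a) +
    t ^+ 2 * (sample_law y * noise h y i a ^+ 2)); last by ring.
  over.
rewrite !big_split -!mulr_sumr /= noise_mean0 sample_law_sum1 mulr0 addr0 mulr1.
apply: lerD.
  apply: ler_wpM2r; rewrite ?sqr_ge0//.
  by have := alpha_gt0 (size h); have := alpha_le1 (size h); rewrite -/t; nra.
rewrite mulrC ler_wpM2r ?sqr_ge0// -[leRHS]mul1r.
rewrite -[X in _ <= X * _]sample_law_sum1 mulr_suml.
apply: ler_sum => y _; rewrite ler_wpM2l ?sample_law_ge0//.
have nb := noise_bounded h y i a.
rewrite -[leLHS]real_normK ?num_real//.
by rewrite lerXn2r ?nnegrE// (le_trans _ nb).
Qed.

Lemma energy_ge0 h : 0 <= energy h.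
Proof. by apply: sumr_ge0 => ia _; exact: sqr_ge0. Qed.

(** The sup norm is attained at an entry, whose square is one term of the energy. *)
Lemma noise_avg_norm h : `|noise_avg h| ^+ 2 <= energy h.
Proof.
have [->|] := eqVneq (`|noise_avg h|) 0; first by rewrite expr0n energy_ge0.
move/(@mx_norm_neq0 _ _ _ (noise_avg h)) => [ia].
rewrite [X in _ -> X ^+ 2 <= _]/Num.norm /= => ->.
rewrite real_normK ?num_real// /energy (bigD1 ia)//= lerDl.
by apply: sumr_ge0 => *; exact: sqr_ge0.
Qed.

(** The bound has the shape required by [averaging_cvg0], with weight [(1 - beta) * alpha] and a
    forcing term proportional to the noise average. *)
Lemma error_recursion Qstar h y : falsified_bellman beta p ct Qstar = Qstar ->
  `|Qhist (y :: h) - Qstar - noise_avg (y :: h)| <=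
  (1 - (1 - beta) * alpha (size h)) * `|Qhist h - Qstar - noise_avg h| +
  (1 - beta) * alpha (size h) * (beta / (1 - beta) * `|noise_avg h|).
Proof.
move=> fixQ; set t := alpha _.
have t0 : 0 < t by exact: alpha_gt0.
have t1 : t <= 1 by exact: alpha_le1.
(* The noise average has the same damping as the iterates, so subtracting it cancels the noise
   exactly. *)
have -> : Qhist (y :: h) - Qstar - noise_avg (y :: h) =
    (1 - t) *: (Qhist h - Qstar - noise_avg h) +
    t *: (falsified_bellman beta p ct (Qhist h) - falsified_bellman beta p ct Qstar).
  rewrite fixQ; apply/matrixP => i a; rewrite /= !mxE -/t /noise.
  by ring.
apply: (le_trans (ler_normD _ _)); rewrite !normrZ !ger0_norm; [|lra..].
have h1 := falsified_bellman_contraction (Qhist h) Qstar.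
have h2 : `|Qhist h - Qstar| <= `|Qhist h - Qstar - noise_avg h| + `|noise_avg h|.
  by rewrite -[X in `|X| <= _](subrK (noise_avg h)) ler_normD.
have -> : (1 - beta) * t * (beta / (1 - beta) * `|noise_avg h|) =
    t * (beta * `|noise_avg h|).
  by field; rewrite subr_eq0 gt_eqF.
have h3 := ler_wpM2l (ltW beta_gt0) h2.
have h4 := ler_wpM2l (ltW t0) (le_trans h1 h3).
lra.
Qed.

End Qlearning_histories.

(** * Law of the histories generated by the simulated variables *)

Section sampled_paths.
Context (R : realType) (s m : nat) (p : 'I_s.+1 -> 'I_s.+1 -> 'I_m.+1 -> R).
Context (d : measure_display) (Omega : measurableType d) (P : probability Omega R).
Variable Psi : nat -> 'I_s.+1 -> 'I_m.+1 -> {RV P >-> 'I_s.+1}.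
Hypothesis Psi_law : forall n i a (j : 'I_s.+1),
  distribution P (Psi n i a) [set j] = (p i j a)%:E.
Hypothesis Psi_indep : mutually_independent
  (fun k : nat * 'I_s.+1 * 'I_m.+1 => Psi k.1.1 k.1.2 k.2).

Definition joint_sample n w : sample (s := s) (m := m) :=
  [ffun ia => Psi n ia.1 ia.2 w].

(** Histories list the latest value first; after reversal, position [k] is time [k]. *)
Lemma history_eq (Y : eqType) (y0 : Y) (x : nat -> Y) h :
  history x (size h) = h <-> forall k, (k < size h)%N -> x k = nth y0 (rev h) k.
Proof.
elim: h => [|y h IH] //=; rewrite rev_cons; split.
  move=> [<- hE] k; rewrite ltnS leq_eqVlt nth_rcons size_rev => /orP[/eqP->|kh].
    by rewrite ltnn eqxx.
  by rewrite kh; apply: (IH.1 hE).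
move=> xE; congr cons.
  by rewrite xE// nth_rcons size_rev ltnn eqxx.
apply/IH => k kh; rewrite xE; last exact: ltnW.
by rewrite nth_rcons size_rev kh.
Qed.

Let y0 : sample (s := s) (m := m) := [ffun=> ord0].
Let target h (k : nat * 'I_s.+1 * 'I_m.+1) : set 'I_s.+1 :=
  [set nth y0 (rev h) k.1.1 (k.1.2, k.2)].
(** The finite subfamily to which independence is applied: all pairs at all times below [n]. *)
Let coordinates n : {fset nat * 'I_s.+1 * 'I_m.+1} :=
  [fset (val x.1, x.2.1, x.2.2) | x in [set: 'I_n * ('I_s.+1 * 'I_m.+1)]%SET]%fset.

Lemma history_eventE h :
  [set w | history (joint_sample^~ w) (size h) = h] =
  \bigcap_(k in [set` coordinates (size h)]) (Psi k.1.1 k.1.2 k.2 @^-1` target h k).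
Proof.
apply/seteqP; split => w /=.
  move=> /(history_eq _ y0) hE _ /imfsetP[[k [i a]] _ ->] /=.
  by rewrite /target /= -hE// ffunE.
move=> hE; apply/(history_eq _ y0) => k kh; apply/ffunP => -[i a]; rewrite ffunE /=.
apply: (hE (k, i, a)) => /=; apply/imfsetP; exists (Ordinal kh, (i, a)) => //=.
by rewrite inE.
Qed.

Lemma measurable_sampled_history h :
  measurable [set w | history (joint_sample^~ w) (size h) = h].
Proof.
rewrite history_eventE; apply: fin_bigcap_measurable => // k _.
by rewrite -[X in measurable X]setTI; exact: measurable_funP.
Qed.

Lemma sampled_history_law h :
  P [set w | history (joint_sample^~ w) (size h) = h] =
  (\prod_(y <- h) sample_law p y)%:E.
Proof.
rewrite history_eventE Psi_indep//.
rewrite (eq_bigr (fun k =>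
  (p k.1.2 (nth y0 (rev h) k.1.1 (k.1.2, k.2)) k.2)%:E)) => [|k _].
  rewrite big_imfset/=; last first.
    by move=> [k1 [i1 a1]] [k2 [i2 a2]] _ _ /= [/val_inj-> -> ->].
  (* Regroup the product over coordinates by time; reversing the history matches times with list
     positions. *)
  rewrite prodEFin big_enum -[h in RHS]revK big_rev (big_nth y0) size_rev big_mkord.
  rewrite pair_bigA /=; congr _%:E; apply: eq_big => [x|x _]; first by rewrite inE.
  by rewrite -surjective_pairing.
by rewrite -(Psi_law k.1.1 k.1.2 k.2).
Qed.

End sampled_paths.

(** * Pathwise convergence and conclusion *)

Lemma cvg0_of_sqr (R : realType) (x y : R^nat) : (forall n, x n ^+ 2 <= y n) ->
  y @ \oo --> 0 -> x @ \oo --> 0.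
Proof.
move=> xy /cvgrPdist_lt y0; apply/cvgrPdist_lt => e e0.
have := y0 (e ^+ 2); rewrite exprn_gt0// => /(_ isT); apply: filterS => n.
rewrite !sub0r !normrN => yn.
rewrite -(ltr_pXn2r (n := 2))// ?nnegrE ?ltW// real_normK ?num_real//.
by rewrite (le_lt_trans (xy n))// (le_lt_trans (ler_norm _)).
Qed.

(** Purely deterministic: vanishing energy kills the noise average, hence the forcing in the error
    recursion, and the triangle inequality recovers the iterates. *)
Lemma Qhist_cvg (R : realType) (s m : nat)
    (p : 'I_s.+1 -> 'I_s.+1 -> 'I_m.+1 -> R) (beta : R) (ct : 'M[R]_(s.+1, m.+1))
    (alpha : nat -> R) (Q0 Qstar : 'M[R]_(s.+1, m.+1)) (x : nat -> sample) :
  transition_kernel p -> 0 < beta -> beta < 1 ->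
  (forall n, 0 < alpha n) -> (forall n, alpha n <= 1) ->
  series alpha @ \oo --> +oo -> falsified_bellman beta p ct Qstar = Qstar ->
  energy p beta ct alpha Q0 (history x n) @[n --> \oo] --> 0 ->
  Qhist beta ct alpha Q0 (history x n) @[n --> \oo] --> Qstar.
Proof.
move=> pk b0 b1 a0 a1 aoo fixQ en0.
pose W n := noise_avg p beta ct alpha Q0 (history x n).
pose Q n := Qhist beta ct alpha Q0 (history x n).
have W0 : `|W n| @[n --> \oo] --> 0.
  by apply: cvg0_of_sqr en0 => n; exact: noise_avg_norm.
have D0 : `|Q n - Qstar - W n| @[n --> \oo] --> 0.
  apply: (averaging_cvg0 R (fun n => (1 - beta) * alpha n)
    (fun n => beta / (1 - beta) * `|W n|)) => //.
  - by move=> n; have := a0 n; have := a1 n; nra.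
  - rewrite (_ : series _ = (fun n => (1 - beta) * series alpha n)).
      apply/cvgryPge => A; move/cvgryPge: aoo => /(_ (A / (1 - beta))).
      by apply: filterS => n; rewrite ler_pdivrMr ?subr_gt0// mulrC.
    by apply/funext => n; rewrite /series /= mulr_sumr.
  - by rewrite -[X in _ --> X](mulr0 (beta / (1 - beta))); exact: cvgMr.
  - move=> n; have := error_recursion p beta ct alpha Q0 pk b0 b1 a0 a1
      Qstar (history x n) (x n) fixQ.
    by rewrite size_history.
apply/cvgrPdist_lt => e e0.
have : `|Q n - Qstar - W n| + `|W n| @[n --> \oo] --> 0.
  by rewrite -[X in _ --> X]addr0; exact: cvgD.
move=> /cvgrPdist_lt/(_ _ e0); apply: filterS => n; rewrite sub0r normrN => h.
rewrite distrC -[X in `|X|](subrK (W n)).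
exact: le_lt_trans (ler_normD _ _) (le_lt_trans (ler_norm _) h).
Qed.

Theorem lemma1 (R : realType) (s m : nat)
    (p : 'I_s.+1 -> 'I_s.+1 -> 'I_m.+1 -> R) (p_kernel : transition_kernel p)
    (beta : R) (beta_gt0 : 0 < beta) (beta_lt1 : beta < 1)
    (ct : 'M[R]_(s.+1, m.+1))
    (alpha : nat -> R)
    (alpha_gt0 : forall n, 0 < alpha n) (alpha_le1 : forall n, alpha n <= 1)
    (alpha_sum : series alpha @ \oo --> +oo)
    (alpha_sqr_sum : cvgn (series (fun n => alpha n ^+ 2)))
    (d : measure_display) (Omega : measurableType d) (P : probability Omega R)
    (Psi : nat -> 'I_s.+1 -> 'I_m.+1 -> {RV P >-> 'I_s.+1})
    (Psi_law : forall n i a (j : 'I_s.+1), distribution P (Psi n i a) [set j] = (p i j a)%:E)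
    (Psi_indep : mutually_independent
       (fun k : nat * 'I_s.+1 * 'I_m.+1 => Psi k.1.1 k.1.2 k.2))
    (Q0 : 'M[R]_(s.+1, m.+1)) :
  exists Qstar : 'M[R]_(s.+1, m.+1),
    [/\ falsified_bellman beta p ct Qstar = Qstar,
        forall Q, falsified_bellman beta p ct Q = Q -> Q = Qstar
      & {ae P, forall w : Omega,
          (fun n => Qlearning beta ct alpha Q0 (fun k i a => Psi k i a w) n)
            @ \oo --> Qstar}].
Proof.
have [Qstar fixQ uniqQ] := contraction_fixed_point R s m
  (falsified_bellman beta p ct) beta
  (introT andP (conj (ltW beta_gt0) beta_lt1))
  (falsified_bellman_contraction p beta ct p_kernel beta_gt0).
exists Qstar; split => //.
have noise_var_ge0 : 0 <= noise_var (s := s) (m := m) beta ct Q0.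
  by apply: sumr_ge0 => ia _; exact: sqr_ge0.
have := robbins_monro_cvg0 _ _ (sample_law p) _ _ P (joint_sample R s m _ _ P Psi)
  (sample_law_ge0 p p_kernel) (sample_law_sum1 p p_kernel)
  (measurable_sampled_history R s m _ _ P Psi)
  (sampled_history_law R s m p _ _ P Psi Psi_law Psi_indep)
  alpha _ _ alpha_gt0 alpha_le1 alpha_sum alpha_sqr_sum noise_var_ge0
  (energy_ge0 p beta ct alpha Q0)
  (step_energy p beta ct alpha Q0 p_kernel beta_gt0 beta_lt1 alpha_gt0 alpha_le1).
apply: filterS => w energy0.
(* On each path the algorithm is [Qhist] along the history of joint samples. *)
rewrite (_ : (fun n => Qlearning _ _ _ _ _ n) =
    fun n => Qhist beta ct alpha Q0 (history ((joint_sample R s m _ _ P Psi)^~ w) n)).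
  exact: Qhist_cvg energy0.
apply/funext => n; rewrite -Qlearning_history; congr Qlearning.
by apply/funext => k; apply/funext => i; apply/funext => a; rewrite ffunE.
Qed.
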